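(* Let $G_\phi$ be a signed graph with sink $q$ and connected underlying graph $G$, and let $L=L_{G_\phi}$ and $M=L_G$ denote the respective reduced Laplacians. Let $\vec{\epsilon}_G$ denote the identity of the critical group $\mathcal{K}(G)$ (as a critical configuration of $G$). Then the identity of $\mathcal{K}(G_\phi)$ (as a critical configuration of $G_\phi$) is $$\vec{\epsilon}_{G_\phi}=LM^{-1}\vec{\epsilon}_G.$$
   Context: A signed graph $G_\phi$ is a finite simple graph $G=(V,E)$ with a sign function $\phi:E\to\{+,-\}$. A vertex $q$ is chosen as sink and $v_1,\dots,v_n$ are the other (nonsink) vertices. The reduced signed Laplacian $L=L_{G_\phi}$ is the $n\times n$ matrix with $L_{ii}=\deg_G(v_i)$ (counting edges to $q$) and, for $i\neq j$, $L_{ij}=-1$ if $v_iv_j$ is a positive edge, $+1$ if it is a negative edge, $0$ if it is not an edge. $M=L_G$ is the same matrix for the all-positive signing. With $G$ connected, both are invertible and $M^{-1}$ has nonnegative entries. The critical groups are $\mathcal{K}(G_\phi)=\mathbb{Z}^n/\mathrm{im}\,L_{G_\phi}$ and $\mathcal{K}(G)=\mathbb{Z}^n/\mathrm{im}\,L_G$. For a pair $(L,M)$, the valid configurations are $S^+=\{\vec{c}\in\mathbb{Z}^n: ML^{-1}\vec{c}\ge\vec{0}\}$. For $\vec{c}\in S^+$: site $i$ is ready to fire if $\vec{c}-L\vec{e}_i\in S^+$, and replacing $\vec{c}$ by $\vec{c}-L\vec{e}_i$ is then a legal firing; $\vec{c}$ is stable if no site is ready to fire; $\vec{c}$ is reachable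 if there is $\vec{d}\in S^+$ at which every site is ready to fire and from which $\vec{c}$ is obtained by a finite sequence of legal firings; $\vec{c}$ is critical if it is stable and reachable. Critical configurations of $G_\phi$ use the pair $(L_{G_\phi},L_G)$; critical configurations of $G$ use the pair $(L_G,L_G)$, for which $S^+=\mathbb{Z}^n_{\ge0}$. Each class of $\mathbb{Z}^n/\mathrm{im}\,L$ contains exactly one critical configuration (a theorem of Guzmán and Klivans), and elements of the critical group are identified with these representatives; so $\vec{\epsilon}_{G_\phi}$ (resp. $\vec{\epsilon}_G$) is the unique critical configuration of $G_\phi$ (resp. $G$) lying in $\mathrm{im}\,L_{G_\phi}$ (resp. $\mathrm{im}\,L_G$). *)

(* Defs.v *)
From Stdlib Require Import Relation_Operators.
From mathcomp Require Import all_boot all_order all_algebra.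

Set Implicit Arguments.
Unset Strict Implicit.
Unset Printing Implicit Defensive.

Import Order.TTheory GRing.Theory Num.Theory.
Local Open Scope ring_scope.

(* A sign function on the edges is encoded by the set of negative edges; the
   positive edges are the remaining ones. *)
Record signed_graph (T : finType) := SignedGraph {
  adj : rel T;
  neg : rel T;
  adj_sym : symmetric adj;
  adj_irr : irreflexive adj;
  neg_sym : symmetric neg;
  neg_adj : subrel neg adj
}.

Definition connected_graph (T : finType) (G : signed_graph T) : Prop :=
  forall x y : T, connect (adj G) x y.

Definition deg (T : finType) (G : signed_graph T) (x : T) : nat :=
  #|[set y | adj G x y]|.

Definition all_positive (T : finType) (G : signed_graph T) : signed_graph T :=
  @SignedGraph T (adj G) (fun _ _ => false) (@adj_sym T G) (@adj_irr T G)
    (fun _ _ => erefl) (fun _ _ (h : false) => False_ind _ (notF h)).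

(* v lists the nonsink vertices v_1, ..., v_n. *)
Definition enumerates_nonsink (T : finType) (q : T) (n : nat) (v : 'I_n -> T)
  : Prop := injective v /\ codom v =i predC1 q.

(* The degree counts all neighbours in T, hence also the edges to the sink. *)
Definition reduced_laplacian (T : finType) (G : signed_graph T) (n : nat)
    (v : 'I_n -> T) : 'M[int]_n :=
  \matrix_(i, j)
    if i == j then (deg G (v i))%:Z
    else if neg G (v i) (v j) then 1
    else if adj G (v i) (v j) then -1
    else 0.

Definition toQ (m n : nat) (A : 'M[int]_(m, n)) : 'M[rat]_(m, n) :=
  map_mx intr A.

Section ChipFiring.
Variables (n : nat) (L M : 'M[int]_n).
Implicit Types c d : 'cV[int]_n.

(* c belongs to S^+; invmx is the true inverse only for invertible L. *)
Definition valid c : Prop :=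
  forall i : 'I_n, 0 <= (toQ M *m invmx (toQ L) *m toQ c) i 0.

Definition fire c (i : 'I_n) : 'cV[int]_n := c - L *m delta_mx i 0.

Definition ready c (i : 'I_n) : Prop := valid (fire c i).

Definition legal_firing c d : Prop :=
  valid c /\ exists i : 'I_n, ready c i /\ d = fire c i.

Definition stable c : Prop := valid c /\ forall i : 'I_n, ~ ready c i.

Definition reachable c : Prop :=
  exists d, [/\ valid d, forall i : 'I_n, ready d i
             & clos_refl_trans _ legal_firing d c].

Definition critical c : Prop := stable c /\ reachable c.

(* c is a critical representative of the zero class of Z^n / im L. *)
Definition critical_identity c : Prop :=
  critical c /\ exists z : 'cV[int]_n, c = L *m z.

End ChipFiring.

(* Main.v *)
Require Import Defs.
From mathcomp Require Import all_boot all_order all_algebra.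
From Stdlib Require Import Relation_Operators.

Import Order.TTheory GRing.Theory Num.Theory.

Local Open Scope ring_scope.

(** Write a configuration in the zero class as [L *m z].  As [L] is invertible,
    [M L^-1 (L z) = M z], so the pair [(L, M)] declares [L *m z] valid exactly
    when [M *m z] is nonnegative: a condition on the script [z] in which [L] does
    not occur.  Firing site [i] subtracts the basis vector [e_i] from the script,
    whatever [L] is, so validity, legal firing, stability and reachability are
    all properties of [z] and [M] alone ([transfer_critical]).  The predecessors
    of [L *m z] along legal firings stay in the image of [L], so reachability is
    captured although its starting point ranges over all configurations.

    Hence if [epsG = M *m z] is critical for [(M, M)], then [L *m z], which is
    [L M^-1 epsG], is critical for [(L, M)]; and any critical [L *m z'] for
    [(L, M)] gives a critical [M *m z'] for [(M, M)].  Uniqueness thus reduces to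
    the ordinary graph, where it follows from Dhar's burning criterion
    ([no_forbidden_reachable], [critical_uniq]).  Both reduced Laplacians are
    invertible over the rationals by a maximum principle which does not see the
    signs of the edges ([reduced_laplacian_unit]). *)

(** * Transfer of chip-firing between pairs with the same M *)

Section Transfer.
Context {n : nat}.
Implicit Types (K L M : 'M[int]_n) (w z : 'cV[int]_n).

Lemma toQ_mulmx L z : toQ (L *m z) = toQ L *m toQ z.
Proof. exact: map_mxM. Qed.

Lemma toQ_ge0 (A : 'cV[int]_n) :
  (forall i, 0 <= toQ A i 0) <-> (forall i, 0 <= A i 0).
Proof. by split=> nn i; have:= nn i; rewrite [toQ A i 0]mxE ler0z. Qed.

Lemma valid_mulmx L M z : toQ L \in unitmx ->
  valid L M (L *m z) <-> forall i, 0 <= (M *m z) i 0.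
Proof.
move=> uL; rewrite /valid !toQ_mulmx -mulmxA mulKmx // -toQ_mulmx.
exact: toQ_ge0.
Qed.

Lemma valid_diag M c : toQ M \in unitmx ->
  valid M M c <-> forall i, 0 <= c i 0.
Proof.
move=> uM; rewrite /valid mulmxV // mul1mx.
exact: toQ_ge0.
Qed.

Lemma fire_mulmx L z i : fire L (L *m z) i = L *m (z - delta_mx i 0).
Proof. by rewrite /fire mulmxBr. Qed.

(** The induction pins down the script of the end of the path, and recovers from
    it the script of each earlier configuration; this is why the start need not
    be assumed to lie in the image of [K]. *)
Lemma transfer_path K L M d c z : toQ K \in unitmx -> toQ L \in unitmx ->
  clos_refl_trans _ (legal_firing K M) d c -> c = K *m z ->
  exists2 w, d = K *m w &
    clos_refl_trans _ (legal_firing L M) (L *m w) (L *m z).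
Proof.
move=> uK uL path_dc.
elim: path_dc z => {d c}
  [d c [dV [i [rdy ->]]]|d|d e c _ IHde _ IHec] z.
- move=> fE.
  (* Undoing the firing of [i] adds [e_i] to the script. *)
  have dE : d = K *m (z + delta_mx i 0).
    by rewrite mulmxDr -fE /fire subrK.
  exists (z + delta_mx i 0) => //; apply: rt_step; split.
    by apply/valid_mulmx => //; apply/(valid_mulmx K) => //; rewrite -dE.
  exists i; rewrite /ready fire_mulmx addrK; split=> //.
  apply/valid_mulmx => //; apply/(valid_mulmx K) => //.
  by rewrite -fE.
- by move=> ->; exists z => //; apply: rt_refl.
move=> /IHec[w eE pwz]; have [u dE puw] := IHde w eE.
by exists u => //; apply: rt_trans puw pwz.
Qed.

Lemma transfer_critical K L M z : toQ K \in unitmx -> toQ L \in unitmx ->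
  critical K M (K *m z) -> critical L M (L *m z).
Proof.
move=> uK uL.
have valKL w : valid K M (K *m w) <-> valid L M (L *m w).
  by split=> /valid_mulmx wV; apply/valid_mulmx => //; apply: wV.
case=> -[/valKL zV zS] [d [dV dR path_dz]].
have [w dE pwz] := transfer_path _ L _ _ _ z uK uL path_dz erefl.
split; first split=> // i.
  by rewrite /ready fire_mulmx => /valKL; rewrite -fire_mulmx; apply: zS.
exists (L *m w); split=> // [|i]; first by apply/valKL; rewrite -dE.
by rewrite /ready fire_mulmx; apply/valKL; rewrite -fire_mulmx -dE; apply: dR.
Qed.

End Transfer.

(** * Uniqueness of critical configurations for the pair (M, M) *)

Section Dhar.
Context {n : nat} {M : 'M[int]_n}.
Context (offdiag_le0 : forall i j, i != j -> M i j <= 0)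
        (rowsum_ge0 : forall i, 0 <= \sum_j M i j)
        (unitM : toQ M \in unitmx).
Implicit Types c d : 'cV[int]_n.

(** The burning criterion: for a graph, [- \sum_(j in A :\ i) M i j] is the number
    of neighbours of [i] in [A], and [A] is a forbidden subconfiguration when
    every site of [A] holds fewer chips than that. *)
Definition no_forbidden c : Prop :=
  forall A : {set 'I_n}, A != set0 ->
  exists2 i, i \in A & - (\sum_(j in A :\ i) M i j) <= c i 0.

(** The omitted entries of the row are off-diagonal, hence nonpositive. *)
Lemma rowsum_sub_ge0 i (A : {set 'I_n}) : i \in A -> 0 <= \sum_(j in A) M i j.
Proof.
move=> Ai; apply: le_trans (rowsum_ge0 i) _.
rewrite (bigID (mem A)) /= gerDl; apply: sumr_le0 => j Aj.
by apply: offdiag_le0; apply: contraNneq Aj => <-.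
Qed.

Lemma fireE c k i : fire M c k i 0 = c i 0 - M i k.
Proof. by rewrite /fire -colE !mxE. Qed.

Lemma no_forbidden_ready d : (forall i, ready M M d i) -> no_forbidden d.
Proof.
move=> dR A /set0Pn[i Ai]; exists i => //.
have /valid_diag/(_ i) := dR i; rewrite fireE subr_ge0 => /(_ unitM).
apply: le_trans; rewrite lerNl -subr_ge0 opprK addrC.
by rewrite -big_setD1 ?rowsum_sub_ge0.
Qed.

(** If [k] is not in [A], every site of [A] gains chips.  If it is, a good site
    [i] for [A :\ k] receives [- M i k] chips, exactly what the larger set [A]
    demands in addition; and for [A = [set k]] nothing is demanded beyond the
    validity of the new configuration. *)
Lemma no_forbidden_fire c k :
  ready M M c k -> no_forbidden c -> no_forbidden (fire M c k).
Proof.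
move=> /(valid_diag _ _ unitM) cR cA A A0.
have [Ak|Ak] := boolP (k \in A); last first.
  have [i Ai ci] := cA A A0; exists i => //; rewrite fireE.
  apply: le_trans ci _; rewrite lerDl oppr_ge0 offdiag_le0 //.
  by apply: contraNneq Ak => <-.
have [Ak0|/cA[i]] := eqVneq (A :\ k) set0.
  by exists k => //; rewrite Ak0 big_set0 oppr0.
rewrite !inE => /andP[ik Ai] ci; exists i => //; rewrite fireE.
rewrite (big_setD1 k) /=; last by rewrite !inE eq_sym ik.
by rewrite opprD addrC lerB // setDDl setUC -setDDl.
Qed.

Lemma no_forbidden_reachable c : reachable M M c -> no_forbidden c.
Proof.
case=> d [_ /no_forbidden_ready dA path_dc].
elim: path_dc dA => {d c} [d c [_ [i [dR ->]]]|//|d e c _ IHde _ IHec].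
  exact: no_forbidden_fire.
by move/IHde/IHec.
Qed.

(** If [z] were positive somewhere, take the set [A] where it attains its maximum
    [m > 0].  On a row of [A], replacing [z] by [m] on [A] and by [m - 1] off [A]
    can only decrease [M z], and leaves [m - 1] times the row sum plus the partial
    row sum over [A].  So [c] exceeds [d] on [A] by at least that partial sum; at
    the site of [A] which the criterion provides for [d], this makes [c] at least
    the diagonal entry, so that [c] is ready to fire there. *)
Lemma script_le0 c d z :
  stable M M c -> no_forbidden d -> c - d = M *m z -> forall i, z i 0 <= 0.
Proof.
move=> [/(valid_diag _ _ unitM) cV cS] dA cdE i0; rewrite leNgt; apply/negP.
move=> zi0.
pose k := [arg max_(i > i0) z i 0]%O.
have kmax i : z i 0 <= z k 0.
  by rewrite /k; case: arg_maxP => // j _ /(_ i); apply.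
have zk_gt0 : 0 < z k 0 := lt_le_trans zi0 (kmax i0).
pose A := [set i | z i 0 == z k 0].
have [|i Ai di] := dA A; first by apply/set0Pn; exists k; rewrite inE.
apply: (cS i).
(* Firing [i] can only make its own coordinate negative. *)
apply/valid_diag => // j; rewrite fireE; have [->|ji] := eqVneq j i; last first.
  by rewrite subr_ge0 (le_trans _ (cV j)) ?offdiag_le0.
have -> : c i 0 = d i 0 + (M *m z) i 0 by rewrite -cdE !mxE addrCA subrr addr0.
suff : \sum_(j in A) M i j <= (M *m z) i 0.
  rewrite (big_setD1 i) //= => Mz; rewrite subr_ge0.
  by have:= lerD di Mz; rewrite addrCA addNr addr0.
(* [z k 0 - (j \notin A)] is the bound [m] on [A], [m - 1] off [A]. *)
have -> : \sum_(j in A) M i j =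
          \sum_j M i j * (z k 0 - (j \notin A)%:Z) - (z k 0 - 1) * \sum_j M i j.
  rewrite mulr_sumr -sumrB [LHS]big_mkcond /=; apply: eq_bigr => l _.
  case: (l \in A) => /=; last by rewrite mulrC subrr.
  by rewrite subr0 mulrBl mul1r mulrC opprB addrCA subrr addr0.
rewrite lerBlDr mxE ler_wpDr ?mulr_ge0 -?gtz0_ge1 ?subr_ge0 //.
apply: ler_sum => l _; have [lA|lA] := boolP (l \in A).
  by move: (lA); rewrite inE => /eqP->; rewrite subr0.
apply: ler_wnM2l.
  by apply: offdiag_le0; apply: contraNneq lA => <-.
by rewrite lerBrDr lezD1 lt_neqAle kmax andbT; move: lA; rewrite inE.
Qed.

(** [script_le0] applies in both directions, so the script between two critical
    configurations vanishes. *)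
Lemma critical_uniq c d z :
  critical M M c -> critical M M d -> c - d = M *m z -> c = d.
Proof.
move=> [cS /no_forbidden_reachable cA] [dS /no_forbidden_reachable dA] cdE.
suff z0 : z = 0 by apply/eqP; rewrite -subr_eq0 cdE z0 mulmx0.
apply/colP => i; rewrite mxE; apply: le_anti.
rewrite (script_le0 _ _ _ cS dA cdE) -oppr_le0.
have := script_le0 _ _ (- z) dS cA _ i; rewrite mxE; apply.
by rewrite mulmxN -cdE opprB.
Qed.

End Dhar.

(** * Reduced Laplacians of connected signed graphs *)

Section Laplacian.
Context {T : finType} {q : T} {n : nat} {v : 'I_n -> T}.
Context (hv : enumerates_nonsink q v).

Lemma nonsink_inj : injective v. Proof. by case: hv. Qed.

Lemma nonsinkP x : x != q -> exists i, x = v i.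
Proof. by case: hv => _ cv; rewrite -[_ != _]cv => /codomP. Qed.

Lemma nonsink_neq i : v i != q.
Proof. by case: hv => _ cv; rewrite -[_ != _]cv codom_f. Qed.

Lemma offdiag_positive (G : signed_graph T) i j : i != j ->
  reduced_laplacian (all_positive G) v i j <= 0.
Proof. by move=> /negPf ij; rewrite mxE ij /=; case: ifP. Qed.

(** The row of a site sums to the number of its edges to the sink. *)
Lemma rowsum_positive (G : signed_graph T) i :
  0 <= \sum_j reduced_laplacian (all_positive G) v i j.
Proof.
rewrite (bigD1 i) //= mxE eqxx.
have -> : \sum_(j | j != i) reduced_laplacian (all_positive G) v i j =
          - (#|[set j | adj G (v i) (v j)]|)%:Z.
  rewrite -sum1_card -natz natr_sum -sumrN big_mkcond [RHS]big_mkcond.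
  apply: eq_bigr => j _; rewrite mxE inE eq_sym.
  by have [<-|] := eqVneq i j; rewrite ?adj_irr //=; case: ifP.
rewrite subr_ge0 lez_nat -(card_imset _ nonsink_inj).
by apply/subset_leq_card/subsetP => _ /imsetP[j ij ->]; rewrite !inE in ij *.
Qed.

(** Extend a kernel vector by [0] at the sink to a function [f] on all vertices.
    At a nonsink vertex, the degree times [f] is a signed sum of the neighbouring
    values; so where [`|f|] attains its maximum [m], all the neighbours have
    absolute value [m] too, unless that vertex is the sink.  If [m > 0], the sink
    is never met, so by connectedness [`|f|] would be [m] everywhere, including
    at the sink, where it is [0]. *)
Lemma reduced_laplacian_unit (G : signed_graph T) : connected_graph G ->
  toQ (reduced_laplacian G v) \in unitmx.
Proof.
move=> connG; rewrite -unitmx_tr -row_free_unit.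
apply: inj_row_free => x xL0.
(* The sum has at most one term, and none when [y] is the sink. *)
pose f y : rat := \sum_(i | v i == y) x 0 i.
have fv i : f (v i) = x 0 i.
  by rewrite /f (big_pred1 i) // => j; rewrite /= (inj_eq nonsink_inj).
have fq : f q = 0.
  by rewrite /f big1 // => i /eqP viq; have:= nonsink_neq i; rewrite viq eqxx.
pose s y z : rat := if neg G y z then 1 else if adj G y z then -1 else 0.
have eqL i : (deg G (v i))%:R * f (v i) = - \sum_y s (v i) y * f y.
  apply/eqP; rewrite -addr_eq0; apply/eqP.
  have -> : \sum_y s (v i) y * f y = \sum_j s (v i) (v j) * x 0 j.
    rewrite [RHS](partition_big v xpredT) //=; apply: eq_bigr => y _.
    by rewrite mulr_sumr; apply: eq_bigr => j /eqP->.
  have := congr1 (fun A : 'rV_n => A 0 i) xL0; rewrite !mxE => xL0i.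
  apply: etrans xL0i.
  rewrite (bigD1 i) //= [RHS](bigD1 i) //= addrA fv !mxE eqxx; congr (_ + _).
    rewrite /s adj_irr; case: ifP => [/(@neg_adj _ G)|_]; rewrite ?adj_irr //.
    by rewrite mul0r addr0 mulrC.
  apply: eq_bigr => j ji; rewrite !mxE eq_sym (negPf ji) mulrC /s.
  by do 2 case: ifP => // _.
have [z _ zmax] := @arg_maxP _ _ T q xpredT (fun y => `|f y|) isT.
set m : rat := `|f z| in zmax.
have [m_le0|m_gt0] := leP m 0.
  apply/rowP => i; rewrite mxE -fv; apply/eqP; rewrite -normr_le0.
  by apply: le_trans m_le0; apply: zmax.
have closed_max : closed (adj G) [pred y | `|f y| == m].
  apply: intro_closed => [|y w yw /eqP fy]; first exact/sym_connect_sym/adj_sym.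
  have [i yE] : exists i, y = v i.
    apply: nonsinkP; apply: contraTneq m_gt0 => yq.
    by rewrite -fy yq fq normr0 ltxx.
  (* The triangle inequality forces these nonnegative defects to vanish. *)
  have tri : \sum_(u | adj G y u) (m - `|f u|) <= 0.
    rewrite sumrB sumr_const -[#|_|]/(#|[pred u | adj G y u]|).
    rewrite subr_le0.
    have -> : m *+ #|[pred u | adj G y u]| = `|(deg G y)%:R * f y|.
      by rewrite normrM fy normr_nat mulr_natl /deg cardsE.
    rewrite yE eqL normrN (le_trans (ler_norm_sum _ _ _)) //.
    rewrite [leRHS]big_mkcond; apply: ler_sum => u _; rewrite normrM /s.
    case: ifP => [/(@neg_adj _ G)->|_]; first by rewrite normr1 mul1r.
    by case: ifP => _; rewrite ?normrN1 ?normr0 ?mul1r ?mul0r.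
  have ge0 u : adj G y u -> 0 <= m - `|f u|.
    by rewrite subr_ge0 => _; apply: zmax.
  have sum0 : \sum_(u | adj G y u) (m - `|f u|) = 0.
    by apply: le_anti; rewrite tri sumr_ge0.
  have /eqP := psumr_eq0P ge0 sum0 yw.
  by rewrite subr_eq0 eq_sym.
have := closed_connect closed_max (connG z q).
by rewrite !inE eqxx fq normr0 => /esym/eqP m0; rewrite -m0 ltxx in m_gt0.
Qed.

End Laplacian.

(** * The identity of the critical group of a signed graph *)

Theorem theorem4p1 (T : finType) (G : signed_graph T) (q : T) (n : nat)
    (v : 'I_n -> T) (hv : enumerates_nonsink q v) (hG : connected_graph G)
    (L M : 'M[int]_n)
    (hL : L = reduced_laplacian G v)
    (hM : M = reduced_laplacian (all_positive G) v)
    (epsG : 'cV[int]_n) (hepsG : critical_identity M M epsG) :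
  exists epsGphi : 'cV[int]_n,
    unique (critical_identity L M) epsGphi /\
    toQ epsGphi = toQ L *m invmx (toQ M) *m toQ epsG.
Proof.
have uL : toQ L \in unitmx by rewrite hL (reduced_laplacian_unit hv).
have uM : toQ M \in unitmx.
  by rewrite hM (reduced_laplacian_unit hv) //; exact: hG.
case: hepsG => epsC [z epsE]; rewrite epsE in epsC *.
exists (L *m z); split; last by rewrite !toQ_mulmx -!mulmxA mulKmx.
split; first by split; [exact: transfer_critical epsC | exists z].
move=> c' [c'C [z' c'E]]; rewrite c'E in c'C *.
have /(transfer_critical L M M z' uL uM) c'M := c'C.
have MzE : M *m z = M *m z'.
  apply: critical_uniq epsC c'M (esym (mulmxBr _ _ _)) => //.
    by rewrite hM; apply: offdiag_positive.
  by rewrite hM; apply: rowsum_positive hv _.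
suff -> : z = z' by [].
have QzE : toQ z = toQ z'.
  by rewrite -[LHS](mulKmx uM) -toQ_mulmx MzE toQ_mulmx mulKmx.
apply/colP => i; have /colP/(_ i) := QzE.
by rewrite !mxE => /intr_inj.
Qed.
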